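(* Let $n,T\ge2$ be integers, $\kappa_1,\kappa_2>0$ constants and $\alpha\in(0,1/2)$. Let $CI(\cdot)=[l(\cdot),u(\cdot)]$ be a $(1-\alpha)$ confidence interval that has validity over $\Theta^{(2)}$, i.e. $\inf_{\theta\in\Theta^{(2)}}\mathbb{P}_\theta(\beta\in CI(X,Y))\ge1-\alpha$. Then for any $c\in(0,4)$, $$\sup_{\theta\in\Theta^{(1)}}\mathbb{P}_\theta\left(|CI(X,Y)|\ge c(nT)^{-1/2}\right)\ge1-2\alpha-c .$$ Moreover, $$\sup_{\theta\in\Theta^{(1)}}\mathbb{E}_\theta|CI(X,Y)|\ge(nT)^{-1/2}(1-2\alpha)^2/2 .$$
   Context: Model: $Y=M+X\beta+\varepsilon$ and $X=D+u$, where $Y,X,M,D,\varepsilon,u\in\mathbb{R}^{n\times T}$, $\beta\in\mathbb{R}$, $M,D$ are non-random, the entries of $\varepsilon$ are i.i.d. $N(0,\sigma_\varepsilon^2)$, the entries of $u$ are i.i.d. $N(0,\sigma_u^2)$, and $u,\varepsilon$ are independent. The distribution $\mathbb{P}_\theta$ of the data $(X,Y)$ is indexed by $\theta=(M,D,\sigma_\varepsilon,\sigma_u,\beta)$, with expectation $\mathbb{E}_\theta$. Here $\sigma_\varepsilon=\sigma_u=1$. Define $$\Theta^{(2)}=\{\theta=(M,D,1,1,\beta):\ \mathrm{rank}\,M\le2,\ \mathrm{rank}\,D=1,\ |\beta|\le1\},$$ $$\Theta^{(1)}=\{\theta=(M,D,1,1,\beta)\in\Theta^{(2)}:\ \mathrm{rank}\,M=1,\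 M'D=0,\ MD'=0,\ \|M\|_F\ge\kappa_1\sqrt{nT},\ \|D\|_F\ge\kappa_2\sqrt{nT}\}.$$ $\|\cdot\|_F$ is the Frobenius norm. A confidence interval is a measurable map of the data to an interval $[l,u]$ with $l\le u$, and $|CI(\cdot)|=u(\cdot)-l(\cdot)$. *)

(* Defs.v *)
From HB Require Import structures.
From mathcomp Require Import all_boot all_order all_algebra.
From mathcomp Require Import all_classical all_reals all_analysis measurable_realfun.

Set Implicit Arguments.
Unset Strict Implicit.
Unset Printing Implicit Defensive.

Import Order.TTheory GRing.Theory Num.Theory.
Import numFieldNormedType.Exports.

Local Open Scope classical_set_scope.
Local Open Scope ring_scope.

Definition measure_matrix_display : measure_display -> measure_display.
Proof. exact. Qed.

(* The sigma-algebra on matrices is the one generated by the entries; over the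
   reals it is the Borel sigma-algebra. *)
Section measurable_matrix.
Context {d} {T : measurableType d}.
Variables m n : nat.

Let entries : set (set 'M[T]_(m, n)) :=
  [set B | exists (i : 'I_m) (j : 'I_n) (A : set T),
    measurable A /\ B = [set M : 'M[T]_(m, n) | A (M i j)]].

Let matrix_set0 : <<s entries >> set0.
Proof. exact: sigma_algebra0. Qed.

Let matrix_setC A : <<s entries >> A -> <<s entries >> (~` A).
Proof. exact: sigma_algebraC. Qed.

Let matrix_bigcup (F : _^nat) :
  (forall i, <<s entries >> (F i)) -> <<s entries >> (\bigcup_i (F i)).
Proof. exact: sigma_algebra_bigcup. Qed.

HB.instance Definition _ := @isMeasurable.Build (measure_matrix_display d)
  'M[T]_(m, n) <<s entries >> matrix_set0 matrix_setC matrix_bigcup.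

Lemma measurable_mxE i j : measurable_fun [set: 'M[T]_(m, n)] (fun M => M i j).
Proof.
move=> _ A mA; rewrite setTI; apply: sub_sigma_algebra.
by exists i, j, A.
Qed.

Lemma measurable_fun_mxP d' (U : measurableType d') (f : U -> 'M[T]_(m, n)) :
  measurable_fun [set: U] f <->
  forall i j, measurable_fun [set: U] (fun x => f x i j).
Proof.
split=> [mf i j|mf].
  exact: (measurableT_comp (measurable_mxE i j) mf).
apply: (@measurability _ _ _ _ _ _ entries) => //.
move=> _ [_ [i [j [A [mA ->]]]] <-]; exact: mf.
Qed.

End measurable_matrix.

Section iid.
Context {d} {T : measurableType d} {R : realType} (P : probability T R).

Definition cons_pair m (x : T * m.-tuple T) : m.+1.-tuple T :=
  [the m.+1.-tuple T of x.1 :: x.2].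

Lemma measurable_cons_pair m : measurable_fun setT (@cons_pair m).
Proof. exact: measurable_cons. Qed.

HB.instance Definition _ m :=
  isMeasurableFun.Build _ _ _ _ (@cons_pair m) (@measurable_cons_pair m).

Definition mx_of_tuple m n (t : (m * n).-tuple T) : 'M[T]_(m, n) :=
  \matrix_(i, j) tnth t (mxvec_index i j).

Lemma measurable_mx_of_tuple m n : measurable_fun setT (@mx_of_tuple m n).
Proof.
apply/measurable_fun_mxP => i j.
under eq_fun do rewrite mxE.
exact: measurable_tnth.
Qed.

HB.instance Definition _ m n :=
  isMeasurableFun.Build _ _ _ _ (@mx_of_tuple m n) (@measurable_mx_of_tuple m n).

(* The m-fold product measure P \x ... \x P. *)
Fixpoint iid_tuple m : probability (m.-tuple T) R :=
  match m with
  | 0 => \d_([tuple] : 0.-tuple T)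
  | m'.+1 => distribution (P \x iid_tuple m')%E (@cons_pair m')
  end.

Definition iid_mx m n : probability 'M[T]_(m, n) R :=
  distribution (iid_tuple (m * n)) (@mx_of_tuple m n).

Lemma iid_tupleE m (A : 'I_m -> set T) : (forall i, measurable (A i)) ->
  iid_tuple m [set t | forall i, A i (tnth t i)] = (\prod_(i < m) P (A i))%E.
Proof.
elim: m A => [|m IH] A mA.
  rewrite big_ord0 /= diracE mem_set//= => -[]//.
rewrite big_ord_recl -IH// -product_measure1E//; last first.
  rewrite (_ : [set _ | _] =
    \big[setI/setT]_(i < m) ((fun t => tnth t i) @^-1` A (lift ord0 i))).
    apply: bigsetI_measurable => i _; rewrite -[X in measurable X]setTI.
    exact: measurable_tnth.
  rewrite -bigcap_seq; apply/seteqP; split=> t /= tA i.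
    by move=> _; exact: tA.
  by apply: tA => /=; rewrite mem_index_enum.
rewrite /= /distribution /pushforward /=; congr (product_measure1 _ _ _).
apply/seteqP; split=> -[x t] /= H.
  by split=> [|i]; [have := H ord0; rewrite tnth0|have := H (lift ord0 i); rewrite tnthS].
move=> i; case: (unliftP ord0 i) => [j|] ->; rewrite ?tnth0 ?tnthS; last by case: H.
by case: H => _; exact.
Qed.

(* The entries under [iid_mx P m n] are i.i.d. with common law [P]. *)
Lemma iid_mxE m n (A : 'I_m -> 'I_n -> set T) :
  (forall i j, measurable (A i j)) ->
  iid_mx m n [set M | forall i j, A i j (M i j)] =
    (\prod_(i < m) \prod_(j < n) P (A i j))%E.
Proof.
move=> mA; rewrite pair_big/=.
have [g hK gK] : bijective (uncurry (@mxvec_index m n)).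
  have [g hK gK] := curry_mxvec_bij m n.
  by exists g => k; [exact: hK|exact: gK].
pose B k := A (g k).1 (g k).2.
transitivity (\prod_(k < m * n) P (B k))%E; last first.
  rewrite (reindex (uncurry (@mxvec_index m n)))/=; last first.
    by exists g => k _; [exact: hK|exact: gK].
  by apply: eq_bigr => k _; rewrite /B hK.
rewrite -iid_tupleE; last by move=> k; exact: mA.
rewrite /iid_mx /distribution /pushforward; congr (iid_tuple _ _).
apply/seteqP; split=> t /= H.
  move=> k; have := H (g k).1 (g k).2; rewrite mxE.
  by have := gK k; rewrite /B; case: (g k) => i j /= ->.
by move=> i j; rewrite mxE; have := H (mxvec_index i j); rewrite /B (hK (i, j)).
Qed.

End iid.

(* [normal_prob] lives on [measurableTypeR R], which has the same measurable sets
   as [R] but a different display; this is [normal_prob] transported along the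
   identity. The second parameter is the standard deviation; the law is Gaussian
   only when it is nonzero. *)
Section normal_law.
Context {R : realType}.

Definition id_measurableTypeR : measurableTypeR R -> R := idfun.

HB.instance Definition _ := @isMeasurableFun.Build _ _ _ _ id_measurableTypeR
  (@measurable_id _ _ setT).

Definition normal_law (m s : R) : probability R R :=
  distribution (normal_prob m s) id_measurableTypeR.

Lemma normal_lawE m s (A : set R) : normal_law m s A = normal_prob m s A.
Proof. by []. Qed.

End normal_law.

Section model.
Context {R : realType} {n T : nat}.

Local Notation dataT := ('M[R]_(n, T) * 'M[R]_(n, T))%type.

Record param := Param {
  pM : 'M[R]_(n, T) ;
  pD : 'M[R]_(n, T) ;
  psigma_eps : R ;
  psigma_u : R ;
  pbeta : R }.

(* The data (X, Y) as a function of the noise (u, eps). *)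
Definition data (theta : param) (ue : dataT) : dataT :=
  let X := pD theta + ue.1 in
  let Y := pM theta + pbeta theta *: X + ue.2 in
  (X, Y).

Lemma measurable_data theta : measurable_fun setT (data theta).
Proof.
have m1 i j : measurable_fun setT (fun x : dataT => x.1 i j).
  exact: (measurableT_comp (measurable_mxE i j) measurable_fst).
have m2 i j : measurable_fun setT (fun x : dataT => x.2 i j).
  exact: (measurableT_comp (measurable_mxE i j) measurable_snd).
apply: measurable_fun_pair; apply/measurable_fun_mxP => i j.
  under eq_fun do rewrite !mxE.
  exact: measurable_funD.
under eq_fun do rewrite !mxE.
apply: measurable_funD => //; apply: measurable_funD => //.
by apply: measurable_funM => //; exact: measurable_funD.
Qed.

HB.instance Definition _ theta :=
  isMeasurableFun.Build _ _ _ _ (data theta) (measurable_data theta).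

Definition data_law (theta : param) : probability dataT R :=
  distribution
    (iid_mx (normal_law 0 (psigma_u theta)) n T \x
     iid_mx (normal_law 0 (psigma_eps theta)) n T)%E
    (data theta).

Definition frobenius (A : 'M[R]_(n, T)) : R :=
  Num.sqrt (\sum_(i < n) \sum_(j < T) A i j ^+ 2).

Definition Theta2 : set param :=
  [set theta | [/\ psigma_eps theta = 1, psigma_u theta = 1,
     (\rank (pM theta) <= 2)%N, \rank (pD theta) = 1%N &
     `|pbeta theta| <= 1]].

Definition Theta1 (kappa1 kappa2 : R) : set param :=
  [set theta | Theta2 theta /\
   [/\ \rank (pM theta) = 1%N,
       (pM theta)^T *m pD theta = 0,
       pM theta *m (pD theta)^T = 0,
       kappa1 * Num.sqrt (n * T)%:R <= frobenius (pM theta) &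
       kappa2 * Num.sqrt (n * T)%:R <= frobenius (pD theta)]].

Record interval_estimator := IntervalEstimator {
  ci_lo : {mfun dataT >-> R} ;
  ci_hi : {mfun dataT >-> R} ;
  ci_le : forall xy, ci_lo xy <= ci_hi xy }.

Definition ci_set (CI : interval_estimator) xy : set R :=
  `[ci_lo CI xy, ci_hi CI xy]%classic.

Definition ci_length (CI : interval_estimator) xy : R :=
  ci_hi CI xy - ci_lo CI xy.

Definition valid_over (Theta : set param) (alpha : R)
    (CI : interval_estimator) : Prop :=
  ((1 - alpha)%:E <=
   ereal_inf [set data_law theta [set xy | ci_set CI xy (pbeta theta)]
             | theta in Theta])%E.

End model.

Arguments param : clear implicits.
Arguments interval_estimator : clear implicits.

(* Main.v *)
From HB Require Import structures.
Require Import Defs.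
From mathcomp Require Import all_boot all_order all_algebra.
From mathcomp Require Import all_classical all_reals all_analysis.
From mathcomp Require Import measurable_realfun ring lra.

(** Only two parameters matter. Let N = n T, delta = c / sqrt N, and take rank-one
    matrices M and D supported on single entries in different rows and different
    columns, so that M'D = 0 and MD' = 0, and scaled to have the required norms.
    Under theta1 = (M, D, 1, 1, 0) the data are (D + u, M + eps). The parameter
    theta2 = (M - delta D, D, 1, 1, delta) has an M-part of rank at most 2, hence
    lies in the larger class, and its data are
    (D + u, M - delta D + delta (D + u) + eps) = (D + u, M + eps + delta u):
    the factor structure of X has been absorbed into M, and only the noise
    delta u tells the two laws apart.

    Given u, the two laws of Y are Gaussian with independent entries of variance
    one, and their means differ by delta u. The Gaussian change of measure makes their Hellinger affinity
    equal to exp (- delta^2 |u|^2 / 8), so events change in probability by at most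
    (r / 16) delta^2 |u|^2 + 1 / r for every r > 0 [gauss_mx_shift_event]. This
    form is linear in |u|^2, so that only E |u|^2 <= N is needed to average over
    u, and r = 4 / c gives the total variation bound c / 2 [data_law_le].

    An interval that is valid at both parameters therefore contains both 0 and
    delta with theta1-probability at least 1 - 2 alpha - c / 2, and then has
    length at least delta [ci_length_ge_prob]. The first claim follows because
    c / 2 <= c. For the second one, the Markov inequality at c = 1 - 2 alpha
    bounds the mean length from below by
    N^(-1/2) c (c - c / 2) = N^(-1/2) (1 - 2 alpha)^2 / 2. *)

Set Implicit Arguments.
Unset Strict Implicit.
Unset Printing Implicit Defensive.

Import Order.TTheory GRing.Theory Num.Theory.
Import numFieldNormedType.Exports.

Local Open Scope classical_set_scope.
Local Open Scope ring_scope.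

(** * The Gaussian change of measure on the line *)

Lemma ge0_integral_lebesgue_shift (R : realType) (a : R)
    (f : measurableTypeR R -> \bar R) :
  measurable_fun [set: measurableTypeR R] f -> (forall x, (0 <= f x)%E) ->
  (\int[lebesgue_measure]_x f (x + a)%R = \int[lebesgue_measure]_x f x)%E.
Proof.
move=> mf f0.
pose shift (x : measurableTypeR R) : measurableTypeR R := x + a.
have mshift : measurable_fun [set: measurableTypeR R] shift.
  exact: measurable_funD.
pose s : {mfun measurableTypeR R >-> measurableTypeR R} :=
  HB.pack shift (isMeasurableFun.Build _ _ _ _ _ mshift).
transitivity (\int[pushforward lebesgue_measure s]_x f x)%E.
  by rewrite ge0_integral_pushforward.
apply: (@eq_measure_integral _ _ R [set: measurableTypeR R]
  lebesgue_measure (pushforward lebesgue_measure s)) => A mA _; apply/esym.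
apply: (@lebesgue_measure_unique R (pushforward lebesgue_measure s)) => //.
move=> X [[x y] /= xy <-].
rewrite /pushforward /= (_ : _ @^-1` _ = `]x - a, y - a]%classic).
  rewrite !lebesgue_measure_itv/= !lte_fin ltrD2r -!EFinD.
  by case: ifP => // _; congr EFin; ring.
by apply/seteqP; split=> z /=; rewrite !in_itv/= ltrBlDr lerBrDr.
Qed.

(** The Radon-Nikodym derivative of a normal law is only determined up to a null
    set; this identifies it with the explicit density under the integral. *)
Lemma ge0_integral_normal_prob (R : realType) (m s : R)
    (f : measurableTypeR R -> \bar R) :
  measurable_fun [set: measurableTypeR R] f -> (forall x, (0 <= f x)%E) ->
  (\int[normal_prob m s]_x f x =
   \int[lebesgue_measure]_x (f x * (normal_pdf m s x)%:E))%E.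
Proof.
move=> mf f0.
pose nu : {finite_measure set (measurableTypeR R) -> \bar R} := normal_prob m s.
have numu := normal_prob_dominates m s.
rewrite -(@Radon_Nikodym_SigmaFinite.change_of_variables _ _ _
  nu lebesgue_measure numu f)//.
have fi := Radon_Nikodym_SigmaFinite.f_integrable numu.
apply: ae_eq_integral => //.
- exact: emeasurable_funM (measurable_int _ fi).
- apply: emeasurable_funM => //; apply/measurable_EFinP.
  exact: measurable_normal_pdf.
- apply: ae_eqe_mul2l; apply: integral_ae_eq => //=.
  + by apply/measurable_EFinP; exact: measurable_normal_pdf.
  + by move=> E _ mE; rewrite -Radon_Nikodym_SigmaFinite.f_integral.
Qed.

Lemma ge0_integral_normal_law (R : realType) (m s : R) (f : R -> \bar R) :
  measurable_fun [set: R] f -> (forall x, (0 <= f x)%E) ->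
  (\int[normal_law m s]_x f x =
   \int[lebesgue_measure]_x (f x * (normal_pdf m s x)%:E))%E.
Proof.
move=> mf f0.
by rewrite ge0_integral_pushforward// -ge0_integral_normal_prob.
Qed.


(** Completing the square: the density at x - a is the density at x times
    exp (a x - a^2 / 2). *)
Lemma normal_law_shift (R : realType) (a : R) (f : R -> \bar R) :
  measurable_fun [set: R] f -> (forall x, (0 <= f x)%E) ->
  (\int[normal_law 0 1]_x f (x + a)%R =
   \int[normal_law 0 1]_x (f x * (expR (a * x - a ^+ 2 / 2))%:E))%E.
Proof.
move=> mf f0.
have mfs : measurable_fun [set: R] (fun x => f (x + a)).
  by apply: measurableT_comp => //; exact: measurable_funD.
have me : measurable_fun [set: R] (fun x => expR (a * x - a ^+ 2 / 2)).
  by apply: measurableT_comp => //; apply: measurable_funB => //;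
    exact: measurable_funM.
rewrite !ge0_integral_normal_law//; last 2 first.
- by apply: emeasurable_funM => //; exact/measurable_EFinP.
- by move=> x; rewrite mule_ge0// lee_fin expR_ge0.
pose g (x : measurableTypeR R) : \bar R :=
  (f x * (expR (a * x - a ^+ 2 / 2))%:E * (normal_pdf 0 1 x)%:E)%E.
have mg : measurable_fun [set: measurableTypeR R] g.
  apply: emeasurable_funM.
    by apply: emeasurable_funM => //; exact/measurable_EFinP.
  by apply/measurable_EFinP; exact: measurable_normal_pdf.
have g0 x : (0 <= g x)%E.
  by rewrite !mule_ge0// lee_fin ?expR_ge0 ?normal_pdf_ge0.
rewrite -[RHS](ge0_integral_lebesgue_shift a mg g0).
apply: eq_integral => x _; rewrite /g -muleA -EFinM !normal_pdfE ?oner_neq0//.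
congr (_ * _%:E)%E; rewrite mulrCA /normal_fun -expRD; congr (_ * expR _).
by field.
Qed.

(** * The Gaussian change of measure on tuples *)

Lemma ge0_integral_iid_tupleS d (T : measurableType d) (R : realType)
    (P : probability T R) m (f : m.+1.-tuple T -> \bar R) :
  measurable_fun setT f -> (forall t, (0 <= f t)%E) ->
  (\int[iid_tuple P m.+1]_t f t =
   \int[P]_x \int[iid_tuple P m]_t f (cons_pair (x, t)))%E.
Proof.
move=> mf f0; rewrite ge0_integral_distribution// fubini_tonelli1//.
  by apply: measurableT_comp => //; exact: measurable_cons_pair.
by move=> x; exact: f0.
Qed.

Definition shift_tuple (R : realType) m (a : 'I_m -> R) (t : m.-tuple R) :
    m.-tuple R :=
  [tuple tnth t i + a i | i < m].

Lemma measurable_shift_tuple (R : realType) m (a : 'I_m -> R) :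
  measurable_fun setT (shift_tuple a).
Proof.
apply/measurable_fun_tnthP => i.
rewrite (_ : _ \o _ = fun t => tnth t i + a i).
  apply: measurable_funD => //; exact: measurable_tnth.
by apply/funext => t /=; rewrite tnth_mktuple.
Qed.

Lemma measurable_cons_pairr d (T : measurableType d) m (x : T) :
  measurable_fun setT (fun t : m.-tuple T => cons_pair (x, t)).
Proof.
by apply: (@measurable_cons _ _ _ _ (fun=> x) _ id).
Qed.

Lemma shift_tuple_cons (R : realType) m (a : 'I_m.+1 -> R) x t :
  shift_tuple a (cons_pair (x, t)) =
  cons_pair (x + a ord0, shift_tuple (fun i => a (lift ord0 i)) t).
Proof.
apply: eq_from_tnth => i; rewrite tnth_mktuple.
by case: (unliftP ord0 i) => [j|] ->; rewrite ?tnth0 ?tnthS ?tnth_mktuple.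
Qed.

(** Densities of product measures multiply: Tonelli peels off one coordinate at
    a time. *)
Lemma ge0_integral_normal_tuple_shift (R : realType) m (a : 'I_m -> R)
    (f : m.-tuple R -> \bar R) :
  measurable_fun [set: m.-tuple R] f -> (forall x, (0 <= f x)%E) ->
  (\int[iid_tuple (normal_law 0 1) m]_t f (shift_tuple a t) =
   \int[iid_tuple (normal_law 0 1) m]_t
     (f t * (expR (\sum_(i < m) (a i * tnth t i - a i ^+ 2 / 2)))%:E))%E.
Proof.
elim: m a f => [|m IH] a f mf f0.
  apply: eq_integral => t _.
  by rewrite big_ord0 expR0 mule1 [in LHS]tuple0 [in RHS]tuple0.
have mL k (b : 'I_k -> R) : measurable_fun [set: k.-tuple R]
    (fun t => (expR (\sum_(i < k) (b i * tnth t i - b i ^+ 2 / 2)))%:E).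
  apply/measurable_EFinP; apply: measurableT_comp => //.
  apply: measurable_sum => i.
  apply: measurable_funB => //; apply: measurable_funM => //.
  exact: measurable_tnth.
have L0 k (b : 'I_k -> R) (t : k.-tuple R) : (0 <=
    (expR (\sum_(i < k) (b i * tnth t i - b i ^+ 2 / 2)))%:E)%E.
  by rewrite lee_fin expR_ge0.
have mfs : measurable_fun [set: m.+1.-tuple R] (f \o shift_tuple a).
  by apply: measurableT_comp => //; exact: measurable_shift_tuple.
rewrite !ge0_integral_iid_tupleS//; last 2 first.
- by apply: emeasurable_funM; [exact: mf|exact: mL].
- by move=> t; rewrite mule_ge0.
pose a' i := a (lift ord0 i).
pose L (t : m.-tuple R) :=
  (expR (\sum_(i < m) (a' i * tnth t i - a' i ^+ 2 / 2)))%:E.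
have Lge0 t : (0 <= L t)%E by exact: L0.
pose g x :=
  (\int[iid_tuple (normal_law 0 1) m]_t (f (cons_pair (x, t)) * L t))%E.
have mF : measurable_fun setT
    (fun z : R * m.-tuple R => (f (cons_pair z) * L z.2)%E).
  apply: emeasurable_funM; last first.
    by apply: (measurableT_comp (mL _ _)); exact: measurable_snd.
  by apply: measurableT_comp => //; exact: measurable_cons_pair.
transitivity (\int[normal_law 0 1]_x (g (x + a ord0)%R))%E.
  apply: eq_integral => x _; rewrite /g -IH//=.
    by apply: eq_integral => t _ /=; rewrite shift_tuple_cons.
  by apply: measurableT_comp => //; exact: measurable_cons_pairr.
rewrite normal_law_shift; last 2 first.
- apply: (@measurable_fun_fubini_tonelli_F _ _ R (m.-tuple R) _
    (iid_tuple (normal_law 0 1) m)) mF _ => z.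
  by rewrite mule_ge0.
- by move=> x; apply: integral_ge0 => t _; rewrite mule_ge0.
apply: eq_integral => x _.
rewrite -(ge0_integralZr _ measurableT) ?lee_fin ?expR_ge0//; last 2 first.
- apply: emeasurable_funM; last exact: mL.
  by apply: measurableT_comp => //; exact: measurable_cons_pairr.
- by move=> t _; rewrite mule_ge0.
apply: eq_integral => t _; rewrite -muleA; congr (_ * _)%E.
rewrite muleC /L -EFinM -expRD big_ord_recl tnth0; congr (expR (_ + _))%:E.
by apply: eq_bigr => i _; rewrite tnthS.
Qed.

(** * Second moments *)

Lemma expR_ge_deg2 (R : realType) (x : R) : 0 <= x ->
  1 + x + x ^+ 2 / 2 <= expR x.
Proof.
move=> x0; have -> : 1 + x + x ^+ 2 / 2 = series (exp_coeff x) 3.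
  rewrite /series/= !big_nat_recr//= big_nil /exp_coeff/=.
  by rewrite add0r expr0 expr1 !fact0 !divr1.
apply: nondecreasing_cvgn_le; last exact: is_cvg_series_exp_coeff.
by apply: nondecreasing_series => n _ _; exact: exp_coeff_ge0.
Qed.

(** With z = y / 2 this says y^2 <= (e^z - e^(-z))^2, so it suffices that
    2 z <= w - 1 / w for the lower bound w = 1 + z + z^2 / 2 of e^z; this holds
    because w^2 - 1 - 2 z w = z^4 / 4. *)
Lemma expR_addN_ge (R : realType) (y : R) :
  2 + y ^+ 2 <= expR y + expR (- y).
Proof.
wlog y0 : y / 0 <= y => [hw|].
  have [/hw//|y0] := leP 0 y.
  have := hw (- y); rewrite opprK sqrrN oppr_ge0 (addrC (expR _)); apply.
  exact: ltW.
pose z := y / 2; have z0 : 0 <= z by rewrite divr_ge0.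
pose w := 1 + z + z ^+ 2 / 2.
have w1 : 1 <= w by rewrite /w -addrA lerDl addr_ge0// divr_ge0// sqr_ge0.
have wE : w <= expR z by exact: expR_ge_deg2.
have wV : expR (- z) <= w^-1.
  by rewrite expRN lef_pV2// posrE ?expR_gt0//; exact: lt_le_trans w1.
have d0 : 2 * z <= w - w^-1.
  have ww : w * w^-1 = 1 by rewrite divff// gt_eqF//; exact: lt_le_trans w1.
  have wV0 : 0 <= w^-1 by rewrite invr_ge0; exact: le_trans w1.
  have -> : w - w^-1 = (w ^+ 2 - 1) * w^-1.
    by rewrite mulrBl expr2 -mulrA ww mulr1 mul1r.
  have -> : 2 * z = (2 * z * w) * w^-1 by rewrite -mulrA ww mulr1.
  apply: ler_wpM2r => //; rewrite -subr_ge0.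
  rewrite (_ : _ - _ = z ^+ 4 / 4) ?divr_ge0 ?exprn_ge0//.
  by rewrite /w; field.
have d : 2 * z <= expR z - expR (- z) by apply: (le_trans d0); exact: lerB.
have d2 : (2 * z) ^+ 2 <= (expR z - expR (- z)) ^+ 2.
  by rewrite ler_sqr ?nnegrE// ?mulr_ge0//; apply: le_trans d; rewrite mulr_ge0.
have ee : expR z * expR (- z) = 1 by rewrite expRxMexpNx_1.
have -> : y = z + z by rewrite /z; field.
rewrite opprD !expRD; move: d2 ee.
by set p := expR z; set q := expR (- z) => *; nra.
Qed.

Lemma integral_cst_probability d (T : measurableType d) (R : realType)
    (P : probability T R) (c : \bar R) : (\int[P]_x c = c)%E.
Proof. by rewrite (integral_cst P measurableT)/= probability_setT mule1. Qed.

Lemma normal_law_mgf (R : realType) (a : R) :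
  (\int[normal_law 0 1]_x (expR (a * x - a ^+ 2 / 2))%:E = 1)%E.
Proof.
have := @normal_law_shift R a (cst 1%E) (measurable_cst _) (fun=> lee01).
rewrite integral_cst_probability => ->.
by apply: eq_integral => x _; rewrite mul1e.
Qed.

(** The exponential moments control the second one: integrating
    2 + a^2 x^2 <= e^(a x) + e^(- a x) with a^2 = 2 s gives
    (2 + 2 s E x^2) e^(- s) <= 2, and s is sent to 0. *)
Lemma normal_law_second_moment_le1 (R : realType) :
  (\int[normal_law 0 1]_x (x ^+ 2)%:E <= 1 :> \bar R)%E.
Proof.
have mX : measurable_fun [set: R] (fun x => (x ^+ 2)%:E).
  by apply/measurable_EFinP; exact: measurable_funX.
have X0 (x : R) : (0 <= (x ^+ 2)%:E)%E by rewrite lee_fin sqr_ge0.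
set I := integral _ _ _.
have I0 : (0 <= I)%E by exact: integral_ge0.
have mE (a s : R) : measurable_fun [set: R] (fun x => (expR (a * x - s))%:E).
  apply/measurable_EFinP; apply: measurableT_comp => //.
  by apply: measurable_funB => //; exact: measurable_funM.
have key (s : R) : 0 < s -> s < 1 ->
    ((2%:E + (2 * s)%:E * I) * (1 - s)%:E <= 2%:E)%E.
  move=> s0 s1; pose a : R := Num.sqrt (2 * s).
  have a2 : a ^+ 2 = 2 * s by rewrite sqr_sqrtr// mulr_ge0// ltW.
  have a2s : a ^+ 2 / 2 = s by rewrite a2; field.
  have m2 : measurable_fun [set: R] (fun x => (a ^+ 2)%:E * (x ^+ 2)%:E)%E.
    by apply: emeasurable_funM.
  have rhsE : (\int[normal_law 0 1]_x
      ((expR (a * x - s))%:E + (expR ((- a) * x - s))%:E) = 2%:E :> \bar R)%E.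
    rewrite ge0_integralD//.
    have := normal_law_mgf a; have := normal_law_mgf (- a).
    by rewrite sqrrN a2s => -> ->.
  rewrite -[leRHS]rhsE.
  have -> : ((2%:E + (2 * s)%:E * I) * (1 - s)%:E =
      \int[normal_law 0 1]_x
        ((2%:E + (a ^+ 2)%:E * (x ^+ 2)%:E) * (1 - s)%:E))%E.
    rewrite ge0_integralZr//; last 3 first.
    - exact: emeasurable_funD.
    - by move=> x _; rewrite adde_ge0// mule_ge0// lee_fin sqr_ge0.
    - by rewrite lee_fin subr_ge0 ltW.
    rewrite ge0_integralD//; last first.
      by move=> x _; rewrite mule_ge0// lee_fin sqr_ge0.
    by rewrite integral_cst_probability ge0_integralZl// ?a2// lee_fin
      mulr_ge0// ltW.
  apply: ge0_le_integral => //.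
  - move=> x _; rewrite mule_ge0//; last by rewrite lee_fin subr_ge0 ltW.
    by rewrite adde_ge0// mule_ge0// lee_fin sqr_ge0.
  - by apply: emeasurable_funM => //; exact: emeasurable_funD.
  - exact: emeasurable_funD.
  move=> x _ /=; rewrite -(EFinM (a ^+ 2) (x ^+ 2)) -!EFinD -EFinM lee_fin.
  rewrite !expRD -mulrDl mulNr -exprMn.
  apply: ler_pM => //.
  - by rewrite addr_ge0// sqr_ge0.
  - by rewrite subr_ge0 ltW.
  - exact: expR_addN_ge.
  - exact: expR_ge1Dx.
move: I0 key; case: I => [r| |]//.
- (* r > 1 is contradicted by any s < 1 - 1/r *)
  rewrite !lee_fin => r0 key; rewrite leNgt; apply/negP => r1.
  have s0 : 0 < (1 - r^-1) / 2 by rewrite divr_gt0// subr_gt0 invf_lt1//; lra.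
  have rV : 0 < r^-1 by rewrite invr_gt0; lra.
  have rr : r * r^-1 = 1 by rewrite divff// gt_eqF//; lra.
  have : (2 + 2 * ((1 - r^-1) / 2) * r) * (1 - (1 - r^-1) / 2) <= 2.
    by rewrite -lee_fin EFinM EFinD EFinM; apply: key => //; lra.
  move: rr rV s0; set v := r^-1 => rr rV s0 H.
  by nra.
- move=> _ /(_ (2^-1)); rewrite invr_gt0 ltr0n invf_lt1// ltr1n => /(_ isT isT).
  rewrite gt0_muley ?lte_fin ?mulr_gt0 ?invr_gt0//.
  rewrite addey// gt0_mulye//.
  by rewrite lte_fin; lra.
Qed.

Lemma iid_tuple_second_moment_le (R : realType) m :
  (\int[iid_tuple (normal_law 0 1) m]_t (\sum_(i < m) tnth t i ^+ 2)%:E <=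
   m%:R%:E :> \bar R)%E.
Proof.
have mS k : measurable_fun [set: k.-tuple R]
    (fun t => (\sum_(i < k) tnth t i ^+ 2)%:E).
  apply/measurable_EFinP; apply: measurable_sum => i.
  by apply: measurable_funX; exact: measurable_tnth.
elim: m => [|m IH].
  by under eq_integral do rewrite big_ord0; rewrite integral0.
have mX : measurable_fun [set: R] (fun x => (x ^+ 2)%:E).
  by apply/measurable_EFinP; exact: measurable_funX.
have sum0 k (t : k.-tuple R) : (0 <= (\sum_(i < k) tnth t i ^+ 2)%:E)%E.
  by rewrite lee_fin sumr_ge0// => i _; rewrite sqr_ge0.
rewrite ge0_integral_iid_tupleS//.
rewrite [leLHS](_ : _ = \int[normal_law 0 1]_x ((x ^+ 2)%:E +
    \int[iid_tuple (normal_law 0 1) m]_t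
      (\sum_(i < m) tnth t i ^+ 2)%:E))%E; last first.
  apply: eq_integral => x _.
  rewrite -[X in (X + _)%E](integral_cst_probability
    (iid_tuple (normal_law 0 1) m)).
  rewrite -ge0_integralD//; last 2 first.
  - by move=> t _; rewrite lee_fin sqr_ge0.
  - exact: mS.
  apply: eq_integral => t _; rewrite big_ord_recl tnth0 -EFinD.
  congr (_ + _)%:E.
  by apply: eq_bigr => i _; rewrite tnthS.
rewrite ge0_integralD//; last 2 first.
- by move=> x _; rewrite lee_fin sqr_ge0.
- by move=> x _; exact: integral_ge0.
rewrite integral_cst_probability -natr1 EFinD addrC.
by apply: leeD => //; exact: normal_law_second_moment_le1.
Qed.

(** * Total variation and Hellinger affinity *)

(** If S^2 is the density of Q with respect to P, then b is the Hellinger affinity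
    of P and Q, and Q E - P E is half the integral of (1_E - 1_(~ E)) (S^2 - 1).
    Bounding |S^2 - 1| = |S - 1| (S + 1) by the weighted mean
    (r (S - 1)^2 + (S + 1)^2 / r) / 2 and integrating gives the claim; the best r
    would give the familiar bound sqrt (1 - b^2). Keeping r free makes the bound
    linear, which lets it be averaged over a random shift. *)
Lemma hellinger_event_bound d (T : measurableType d) (R : realType)
    (P : probability T R) (S : T -> R) (b r : R) (E : set T) :
  measurable_fun setT S -> (forall x, 0 <= S x) ->
  (\int[P]_x (S x ^+ 2)%:E = 1)%E -> (\int[P]_x (S x)%:E = b%:E)%E ->
  measurable E -> 0 < r ->
  (\int[P]_x ((\1_E x)%:E * (S x ^+ 2)%:E) <=
   P E + (r * (1 - b) / 2 + (1 + b) / (2 * r))%:E)%E.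
Proof.
move=> mS S0 intS2 intS mE r0.
have mS1 : measurable_fun setT (fun x => (S x)%:E) by exact/measurable_EFinP.
have mS2 : measurable_fun setT (fun x => (S x ^+ 2)%:E).
  by apply/measurable_EFinP; exact: measurable_funX.
have mI (A : set T) : measurable A ->
    measurable_fun setT (fun x => (\1_A x : R)%:E).
  by move=> mA; apply/measurable_EFinP; exact: measurable_indic.
have I0 (A : set T) x : (0 <= (\1_A x : R)%:E)%E by rewrite lee_fin.
have S20 x : (0 <= (S x ^+ 2)%:E)%E by rewrite lee_fin sqr_ge0.
have S10 x : (0 <= (S x)%:E)%E by rewrite lee_fin.
have mIS : measurable_fun setT (fun x => (\1_E x : R)%:E * (S x ^+ 2)%:E)%E.
  by apply: emeasurable_funM => //; exact: mI.
have IS0 x : (0 <= (\1_E x : R)%:E * (S x ^+ 2)%:E)%E by rewrite mule_ge0.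
have mEC : measurable (~` E) by exact: measurableC.
have rV0 : 0 < r^-1 by rewrite invr_gt0.
pose k := 1 + (r + r^-1) / 2.
have k0 : 0 <= k by rewrite /k; lra.
(* the pointwise inequality of the weighted mean, with all the terms moved to the
   side where they are nonnegative *)
have H : (\int[P]_x (2%:E * ((\1_E x)%:E * (S x ^+ 2)%:E) +
    2%:E * (\1_(~` E) x)%:E + r%:E * (S x)%:E) <=
  \int[P]_x (k%:E * (1 + (S x ^+ 2)%:E) + r^-1%:E * (S x)%:E))%E.
  apply: ge0_le_integral => //.
  - by move=> x _; rewrite !adde_ge0// mule_ge0// lee_fin ltW.
  - apply: emeasurable_funD; last exact: measurable_funeM.
    by apply: emeasurable_funD; apply: measurable_funeM => //; exact: mI.
  - apply: emeasurable_funD; apply: measurable_funeM => //.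
    exact: emeasurable_funD.
  move=> x _.
  have r1 : r * r^-1 = 1 by rewrite divff// gt_eqF.
  suff : 2 * (\1_E x * S x ^+ 2) + 2 * \1_(~` E) x + r * S x <=
      k * (1 + S x ^+ 2) + r^-1 * S x.
    by rewrite -lee_fin !EFinD !EFinM EFinD.
  rewrite !indicE in_setC; case: (x \in E) => /=; rewrite /k -subr_ge0.
  - rewrite [leRHS](_ : _ = r^-1 * (r * (S x - 1) - (S x + 1)) ^+ 2 / 2).
      by rewrite divr_ge0// mulr_ge0// ?sqr_ge0// ltW.
    by field; rewrite gt_eqF.
  - rewrite [leRHS](_ : _ = r^-1 * (r * (S x - 1) + (S x + 1)) ^+ 2 / 2).
      by rewrite divr_ge0// mulr_ge0// ?sqr_ge0// ltW.
    by field; rewrite gt_eqF.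
have m1 : measurable_fun setT
    (fun x => 2%:E * ((\1_E x)%:E * (S x ^+ 2)%:E))%E.
  exact: measurable_funeM.
have m2 : measurable_fun setT (fun x => 2%:E * (\1_(~` E) x : R)%:E)%E.
  by apply: measurable_funeM; exact: mI.
have m3 (c : R) : measurable_fun setT (fun x => c%:E * (S x)%:E)%E.
  exact: measurable_funeM.
have m4 : measurable_fun setT (fun x => 1 + (S x ^+ 2)%:E)%E.
  exact: emeasurable_funD.
have p1 x : (0 <= 2%:E * ((\1_E x)%:E * (S x ^+ 2)%:E))%E.
  by rewrite mule_ge0.
have p2 x : (0 <= 2%:E * (\1_(~` E) x : R)%:E)%E by rewrite mule_ge0.
have p3 (c : R) x : 0 <= c -> (0 <= c%:E * (S x)%:E)%E.
  by move=> c0; rewrite mule_ge0.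
have p4 x : (0 <= 1 + (S x ^+ 2)%:E)%E by rewrite adde_ge0.
have lhsE : (\int[P]_x (2%:E * ((\1_E x)%:E * (S x ^+ 2)%:E) +
      2%:E * (\1_(~` E) x)%:E + r%:E * (S x)%:E) =
    2%:E * \int[P]_x ((\1_E x)%:E * (S x ^+ 2)%:E) +
      2%:E * P (~` E) + r%:E * b%:E)%E.
  rewrite ge0_integralD//; last 3 first.
  - by move=> x _; exact: adde_ge0.
  - exact: emeasurable_funD.
  - by move=> x _; apply: p3; exact: ltW.
  rewrite ge0_integralD// !ge0_integralZl// ?lee_fin ?ltW//; last exact: mI.
  by rewrite intS integral_indic// setIT.
have rhsE : (\int[P]_x (k%:E * (1 + (S x ^+ 2)%:E) + r^-1%:E * (S x)%:E) =
   k%:E * 2%:E + r^-1%:E * b%:E)%E.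
  rewrite ge0_integralD//; last 3 first.
  - by move=> x _; exact: mule_ge0.
  - exact: measurable_funeM.
  - by move=> x _; apply: p3; exact: ltW.
  rewrite !ge0_integralZl// ?lee_fin ?ltW// ge0_integralD// intS2 intS.
  by rewrite integral_cst_probability.
have qfin : (\int[P]_x ((\1_E x)%:E * (S x ^+ 2)%:E))%E \is a fin_num.
  rewrite ge0_fin_numE; last exact: integral_ge0.
  apply: (@le_lt_trans _ _ 1%E); last exact: ltry.
  rewrite -intS2; apply: ge0_le_integral => // x _.
  by rewrite -EFinM lee_fin ler_piMl ?sqr_ge0// indicE lern1 leq_b1.
move: H; rewrite lhsE rhsE probability_setC//.
have pfin : P E \is a fin_num by exact: fin_num_measure.
rewrite -(fineK qfin) -(fineK pfin) -EFinB.
set q := fine _; set p := fine _ => H.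
have {}H : 2 * q + 2 * (1 - p) + r * b <= k * 2 + r^-1 * b.
  by move: H; rewrite -lee_fin !EFinD !EFinM.
rewrite -EFinD lee_fin; move: H; rewrite /k.
have -> : (1 + b) / (2 * r) = r^-1 * (1 + b) / 2 by rewrite invfM; ring.
by set v := r^-1; nra.
Qed.

(** * Shifts of Gaussian matrices *)

Lemma sum_mxvec_index (V : zmodType) m n (F : 'I_(m * n) -> V) :
  \sum_(i < m) \sum_(j < n) F (mxvec_index i j) = \sum_(k < m * n) F k.
Proof.
rewrite pair_big/= [RHS](reindex (uncurry (@mxvec_index m n)))/=.
  by apply: eq_bigr => -[].
have [g hK gK] := curry_mxvec_bij m n.
by exists g => k _; [exact: hK|exact: gK].
Qed.

Section gaussian_matrix.
Context {R : realType} {n T : nat}.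
Implicit Types A Z : 'M[R]_(n, T).

Local Notation gauss_mx := (iid_mx (normal_law 0 1 : probability R R) n T).

(** The log-likelihood ratio of the law shifted by A to the standard law. *)
Definition shift_loglik A Z : R :=
  \sum_(i < n) \sum_(j < T) (A i j * Z i j - A i j ^+ 2 / 2).

Definition sumsq A : R := \sum_(i < n) \sum_(j < T) A i j ^+ 2.

Lemma sumsq_ge0 A : 0 <= sumsq A.
Proof.
by apply: sumr_ge0 => i _; apply: sumr_ge0 => j _; exact: sqr_ge0.
Qed.

Lemma measurable_sum_mx (F : 'I_n -> 'I_T -> R -> R) :
  (forall i j, measurable_fun setT (F i j)) ->
  measurable_fun setT (fun Z => \sum_(i < n) \sum_(j < T) F i j (Z i j)).
Proof.
move=> mF; apply: measurable_sum => i; apply: measurable_sum => j.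
by apply: (measurableT_comp (mF i j)); exact: measurable_mxE.
Qed.

Lemma measurable_shift_loglik A : measurable_fun setT (shift_loglik A).
Proof.
apply: (measurable_sum_mx
  (F := fun i j z => A i j * z - A i j ^+ 2 / 2)) => i j.
by apply: measurable_funB => //; exact: measurable_funM.
Qed.

Lemma measurable_sumsq : measurable_fun setT sumsq.
Proof.
apply: (measurable_sum_mx (F := fun i j z => z ^+ 2)) => i j.
exact: measurable_funX.
Qed.

Lemma measurable_mx_addr A : measurable_fun setT (fun Z => Z + A).
Proof.
apply/measurable_fun_mxP => i j; under eq_fun do rewrite mxE.
by apply: measurable_funD => //; exact: measurable_mxE.
Qed.

Lemma integral_gauss_mx_shift A (f : 'M[R]_(n, T) -> \bar R) :
  measurable_fun setT f -> (forall Z, (0 <= f Z)%E) ->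
  (\int[gauss_mx]_Z f (Z + A)%R =
   \int[gauss_mx]_Z (f Z * (expR (shift_loglik A Z))%:E))%E.
Proof.
move=> mf f0.
have mL : measurable_fun setT (fun Z => (expR (shift_loglik A Z))%:E).
  apply/measurable_EFinP; apply: measurableT_comp => //.
  exact: measurable_shift_loglik.
rewrite !ge0_integral_distribution//; last 3 first.
- exact: emeasurable_funM.
- by move=> Z; rewrite mule_ge0// lee_fin expR_ge0.
- by apply: (measurableT_comp mf); exact: measurable_mx_addr.
pose a (k : 'I_(n * T)) : R := mxvec A 0 k.
have mt : measurable_fun [set: (n * T).-tuple R] (fun t => f (mx_of_tuple t)).
  by apply: (measurableT_comp mf); exact: measurable_mx_of_tuple.
transitivity (\int[iid_tuple (normal_law 0 1) (n * T)]_t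
    (f (mx_of_tuple t) *
     (expR (\sum_(k < n * T) (a k * tnth t k - a k ^+ 2 / 2)))%:E))%E.
  rewrite -(ge0_integral_normal_tuple_shift a
    (f := fun t => f (mx_of_tuple t)))//.
  apply: eq_integral => t _ /=; congr f; apply/matrixP => i j.
  by rewrite !mxE tnth_mktuple /a mxvecE.
apply: eq_integral => t _ /=; congr (_ * (expR _)%:E)%E.
rewrite -sum_mxvec_index; apply: eq_bigr => i _; apply: eq_bigr => j _.
by rewrite /a mxvecE mxE.
Qed.

Lemma integral_gauss_mx_sumsq_le :
  (\int[gauss_mx]_Z (sumsq Z)%:E <= (n * T)%:R%:E)%E.
Proof.
rewrite ge0_integral_distribution//; last 2 first.
- by apply/measurable_EFinP; exact: measurable_sumsq.
- by move=> Z; rewrite lee_fin sumsq_ge0.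
apply: le_trans (iid_tuple_second_moment_le R (n * T)).
rewrite le_eqVlt; apply/orP; left; apply/eqP.
apply: eq_integral => t _ /=; congr EFin; rewrite -sum_mxvec_index.
by apply: eq_bigr => i _; apply: eq_bigr => j _; rewrite mxE.
Qed.

(** The square root S of the likelihood ratio for the shift A is b times the
    likelihood ratio for the shift A / 2, which has integral 1; so the Hellinger
    affinity is b = exp (- |A|^2 / 8), and 1 - |A|^2 / 8 <= b <= 1. *)
Lemma gauss_mx_shift_event A (E : set 'M[R]_(n, T)) (r : R) :
  measurable E -> 0 < r ->
  (gauss_mx [set Z | E (Z + A)%R] <=
   gauss_mx E + (r / 16 * sumsq A + r^-1)%:E)%E.
Proof.
move=> mE r0.
have mL B : measurable_fun setT (fun Z => expR (shift_loglik B Z)).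
  by apply: measurableT_comp => //; exact: measurable_shift_loglik.
have total B : (\int[gauss_mx]_Z (expR (shift_loglik B Z))%:E = 1)%E.
  have := @integral_gauss_mx_shift B (cst 1%E) (measurable_cst _) (fun=> lee01).
  rewrite integral_cst_probability => ->.
  by apply: eq_integral => x _; rewrite mul1e.
pose S Z := expR (shift_loglik A Z / 2).
pose b := expR (- (sumsq A / 8)).
have SE Z : S Z = expR (shift_loglik (2^-1 *: A) Z) * b.
  rewrite /S /b -expRD; congr expR.
  rewrite /shift_loglik /sumsq -mulNr mulr_suml -sumrN mulr_suml -big_split/=.
  apply: eq_bigr => i _; rewrite mulr_suml -sumrN mulr_suml -big_split/=.
  apply: eq_bigr => j _.
  by rewrite mxE; field.
have S2E Z : S Z ^+ 2 = expR (shift_loglik A Z).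
  by rewrite /S expr2 -expRD; congr expR; field.
have mS : measurable_fun setT S.
  apply: measurableT_comp => //; apply: measurable_funM => //.
  exact: measurable_shift_loglik.
have mI : measurable_fun setT (fun Z => (\1_E Z : R)%:E).
  by apply/measurable_EFinP; exact: measurable_indic.
have -> : gauss_mx [set Z | E (Z + A)] =
    (\int[gauss_mx]_Z ((\1_E Z)%:E * (S Z ^+ 2)%:E))%E.
  under [RHS]eq_integral do rewrite S2E.
  rewrite -integral_gauss_mx_shift//.
  have mEA : measurable [set Z | E (Z + A)].
    by rewrite -[X in measurable X]setTI; exact: measurable_mx_addr.
  rewrite -[in LHS](setIT [set Z | E (Z + A)]) -integral_indic//.
apply: (le_trans (@hellinger_event_bound _ _ _
  gauss_mx S b r E mS _ _ _ mE r0)).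
- by move=> Z; exact: expR_ge0.
- by under eq_integral do rewrite S2E; exact: total.
- under eq_integral do rewrite SE EFinM.
  rewrite ge0_integralZr//; last 2 first.
  + by apply/measurable_EFinP; exact: mL.
  + by rewrite lee_fin expR_ge0.
  by rewrite total mul1e.
- rewrite leeD2l// lee_fin.
  have b1 : b <= 1 by rewrite /b expR_le1 oppr_le0 divr_ge0 ?sumsq_ge0.
  have bx : 1 - sumsq A / 8 <= b by exact: expR_ge1Dx.
  apply: lerD.
    rewrite -subr_ge0.
    rewrite [leRHS](_ : _ = r / 2 * (b - (1 - sumsq A / 8))); last by field.
    by apply: mulr_ge0; [apply: divr_ge0 => //; exact: ltW|rewrite subr_ge0].
  rewrite invfM mulrA ler_piMl ?invr_ge0 ?(ltW r0)//; lra.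
Qed.

End gaussian_matrix.

(** * Two parameters with close data laws *)

(** Given u, the data of the two parameters differ by the shift delta u of the
    noise eps; [gauss_mx_shift_event] is integrated over u. *)
Lemma data_law_le {R : realType} {n T : nat} (M D : 'M[R]_(n, T)) (delta r : R)
    (A : set ('M[R]_(n, T) * 'M[R]_(n, T))) :
  measurable A -> 0 < r ->
  (data_law (Param (M - delta *: D) D 1 1 delta) A <=
   data_law (Param M D 1 1 0) A +
   (r / 16 * delta ^+ 2 * (n * T)%:R + r^-1)%:E)%E.
Proof.
move=> mA r0.
set th1 := Param M D 1 1 0; set th2 := Param _ D 1 1 delta.
pose g := iid_mx (normal_law 0 1 : probability R R) n T.
have mB th : measurable (data th @^-1` A).
  by rewrite -[X in measurable X]setTI; exact: measurable_data.
pose sect th u := xsection (data th @^-1` A) u.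
have lawE th : psigma_eps th = 1 -> psigma_u th = 1 ->
    data_law th A = (\int[g]_u g (sect th u))%E.
  by case: th => ? ? ? ? ? /= -> ->.
rewrite !lawE//.
pose k := r / 16 * delta ^+ 2.
pose e (u : 'M[R]_(n, T)) : \bar R := (k%:E * (sumsq u)%:E + r^-1%:E)%E.
have k0 : 0 <= k by rewrite mulr_ge0 ?sqr_ge0 ?divr_ge0 ?(ltW r0).
have msq1 : measurable_fun setT (fun u : 'M[R]_(n, T) => (sumsq u)%:E).
  by apply/measurable_EFinP; exact: measurable_sumsq.
have rV0 : 0 <= r^-1 by rewrite invr_ge0 ltW.
have msq : measurable_fun setT
    (fun u : 'M[R]_(n, T) => (k%:E * (sumsq u)%:E)%E).
  exact: measurable_funeM.
have sq0 (u : 'M[R]_(n, T)) : (0 <= k%:E * (sumsq u)%:E)%E.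
  by rewrite mule_ge0// lee_fin sumsq_ge0.
have me : measurable_fun setT e by exact: emeasurable_funD.
have e0 u : (0 <= e u)%E by rewrite adde_ge0.
have ms th : measurable_fun setT (fun u => g (sect th u)).
  exact: measurable_fun_xsection.
have step u : (g (sect th2 u) <= g (sect th1 u) + e u)%E.
  have -> : sect th2 u = [set eps | sect th1 u (eps + delta *: u)].
    apply/seteqP; split => eps; rewrite /sect /xsection /= !inE /data /=;
      congr (A (_, _)); rewrite scale0r addr0 scalerDr !addrA subrK;
      exact: addrAC.
  apply: le_trans (gauss_mx_shift_event _ _ r0) _.
    exact: measurable_xsection.
  rewrite leeD2l// /e -EFinM -EFinD lee_fin lerD2r /k -[leRHS]mulrA ler_wpM2l//.
    by rewrite divr_ge0// ltW.
  rewrite /sumsq mulr_sumr; apply: ler_sum => i _.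
  rewrite mulr_sumr; apply: ler_sum => j _.
  by rewrite mxE exprMn.
apply: (@le_trans _ _ (\int[g]_u (g (sect th1 u) + e u))%E).
  apply: ge0_le_integral => //; exact: emeasurable_funD.
rewrite ge0_integralD// leeD2l// /e ge0_integralD// integral_cst_probability.
rewrite EFinD leeD2r// ge0_integralZl//; last first.
  by move=> u _; rewrite lee_fin sumsq_ge0.
rewrite [leRHS]EFinM lee_wpmul2l ?lee_fin//.
exact: integral_gauss_mx_sumsq_le.
Qed.

(** * Length of a valid interval *)

Section interval_length.
Context {R : realType} {n T : nat} (CI : interval_estimator R n T).

Lemma measurable_ci_set b : measurable [set xy | ci_set CI xy b].
Proof.
rewrite (_ : [set _ | _] =
    ci_lo CI @^-1` `]-oo, b]%classic `&` ci_hi CI @^-1` `[b, +oo[%classic).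
  by apply: measurableI; rewrite -[X in measurable X]setTI;
    exact: measurable_funP.
by apply/seteqP; split => xy; rewrite /ci_set /= !in_itv/= andbT => /andP.
Qed.

Lemma measurable_ci_length : measurable_fun setT (ci_length CI).
Proof. exact: measurable_funB. Qed.

Lemma measurable_ci_length_ge d : measurable [set xy | d <= ci_length CI xy].
Proof.
rewrite (_ : [set _ | _] = ci_length CI @^-1` `[d, +oo[%classic).
  by rewrite -[X in measurable X]setTI; exact: measurable_ci_length.
by apply/seteqP; split => xy; rewrite /= in_itv/= andbT.
Qed.

(** The condition c <= sqrt (n T) keeps the slope delta of the second parameter
    within [-1, 1]; the rank bound 1 on M leaves room for subtracting delta D. *)
Lemma ci_length_ge_prob (M D : 'M[R]_(n, T)) (alpha c : R) :
  (0 < n * T)%N -> 0 < c -> c <= Num.sqrt (n * T)%:R ->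
  (\rank M <= 1)%N -> \rank D = 1%N ->
  valid_over Theta2 alpha CI ->
  ((1 - 2 * alpha - c / 2)%:E <=
   data_law (Param M D 1 1 0)
     [set xy | (c * (Num.sqrt (n * T)%:R)^-1 <= ci_length CI xy)%R])%E.
Proof.
move=> N0 c0 cN rM rD valid.
set s := Num.sqrt _; set delta := c * s^-1.
have s0 : 0 < s by rewrite sqrtr_gt0 ltr0n.
have s2 : s ^+ 2 = (n * T)%:R by rewrite sqr_sqrtr.
have d0 : 0 < delta by rewrite divr_gt0.
set th1 := Param M D 1 1 0; pose th2 := Param (M - delta *: D) D 1 1 delta.
have in1 : Theta2 th1 by split => //=; rewrite ?normr0// (leq_trans rM).
have in2 : Theta2 th2.
  split => //=; last by rewrite gtr0_norm// ler_pdivrMr// mul1r.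
  rewrite (leq_trans (mxrank_add _ _))// (leq_add rM)//.
  rewrite -scaleN1r scalerA.
  by rewrite (leq_trans (mxrankS (scalemx_sub _ (submx_refl _))))// rD.
have cover th : Theta2 th ->
    ((1 - alpha)%:E <= data_law th [set xy | ci_set CI xy (pbeta th)])%E.
  by move=> Hth; apply: (le_trans valid); apply: ereal_inf_lbound; exists th.
set P := data_law th1.
set A := [set xy | ci_set CI xy 0]; set B := [set xy | ci_set CI xy delta].
have mA : measurable A by exact: measurable_ci_set.
have mB : measurable B by exact: measurable_ci_set.
have PA : ((1 - alpha)%:E <= P A)%E by exact: cover in1.
have PB : ((1 - alpha)%:E <= P B + (c / 2)%:E)%E.
  apply: (le_trans (cover _ in2)).
  (* r = 4 / c balances the two error terms, each of which becomes c / 4 *)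
  have r0 : 0 < 4 / c by rewrite divr_gt0.
  apply: (le_trans (data_law_le M D delta mB r0)).
  rewrite leeD2l// lee_fin /delta exprMn exprVn -s2 le_eqVlt.
  apply/orP; left; apply/eqP.
  by field; rewrite !gt_eqF.
have AB : (P A <= P [set xy | delta <= ci_length CI xy]%R + P (~` B))%E.
  apply: (@le_trans _ _ (P ([set xy | delta <= ci_length CI xy]%R `|` ~` B))).
    apply: le_measure; rewrite ?inE//.
      apply: measurableU; last exact: measurableC.
      exact: measurable_ci_length_ge.
    move=> xy Axy; have [Bxy|nBxy] := pselect (B xy); [left|by right].
    move: Axy Bxy; rewrite /A /B /ci_set /= !in_itv/=.
    move=> /andP[l0 h0] /andP[l1 h1].
    by rewrite /ci_length; lra.
  by apply: measureU2; [exact: measurable_ci_length_ge|exact: measurableC].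
move: AB PA PB; rewrite probability_setC//.
have fA : P A \is a fin_num by exact: fin_num_measure.
have fB : P B \is a fin_num by exact: fin_num_measure.
have fL : P [set xy | delta <= ci_length CI xy]%R \is a fin_num.
  by apply: fin_num_measure; exact: measurable_ci_length_ge.
rewrite -(fineK fA) -(fineK fB) -(fineK fL) -EFinB -!EFinD !lee_fin.
by move=> *; lra.
Qed.

Lemma ci_length_expectation_ge
    (P : probability ('M[R]_(n, T) * 'M[R]_(n, T))%type R) (d : R) :
  0 <= d ->
  (d%:E * P [set xy | (d <= ci_length CI xy)%R] <= 'E_P[ci_length CI])%E.
Proof.
move=> d0; rewrite unlock.
set L := [set _ | _].
have mL : measurable L by exact: measurable_ci_length_ge.
have len0 xy : 0 <= ci_length CI xy by rewrite subr_ge0 ci_le.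
rewrite -[L in P L]setIT -integral_indic// -ge0_integralZl//; last first.
  by apply/measurable_EFinP; exact: measurable_indic.
apply: ge0_le_integral => //.
- by move=> xy _; rewrite -EFinM lee_fin mulr_ge0.
- by apply: measurable_funeM; apply/measurable_EFinP; exact: measurable_indic.
- by apply/measurable_EFinP; exact: measurable_ci_length.
move=> xy _; rewrite -EFinM lee_fin indicE.
by have [/[!inE]|_] := boolP (xy \in L); rewrite ?mulr1 ?mulr0.
Qed.

End interval_length.

(** * A parameter with orthogonal spikes, and the main result *)

Lemma frobenius_delta_mx {R : realType} {n T : nat} (i0 : 'I_n) (j0 : 'I_T)
    (a : R) :
  0 <= a -> frobenius (a *: delta_mx i0 j0) = a.
Proof.
move=> a0; rewrite /frobenius (bigD1 i0)//= (bigD1 j0)//= !mxE !eqxx mulr1.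
rewrite big1 => [|j jj]; last by rewrite !mxE (negbTE jj) andbF mulr0 expr0n.
rewrite big1 => [|i ii]; last first.
  by rewrite big1// => j _; rewrite !mxE (negbTE ii) mulr0 expr0n.
by rewrite !addr0 sqrtr_sqr ger0_norm.
Qed.

Lemma Theta1_orthogonal_spikes {R : realType} {n T : nat} (k1 k2 : R)
    (i1 i2 : 'I_n) (j1 j2 : 'I_T) :
  i1 != i2 -> j1 != j2 -> 0 < k1 -> 0 < k2 ->
  let N := Num.sqrt (n * T)%:R in
  Theta1 k1 k2
    (Param ((k1 * N) *: delta_mx i1 j1) ((k2 * N) *: delta_mx i2 j2) 1 1 0).
Proof.
move=> ii jj k10 k20 N.
have N0 : 0 < N.
  rewrite sqrtr_gt0 ltr0n muln_gt0 (leq_ltn_trans _ (ltn_ord i1))//.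
  exact: leq_ltn_trans (ltn_ord j1).
have a1 : 0 < k1 * N by rewrite mulr_gt0.
have a2 : 0 < k2 * N by rewrite mulr_gt0.
have rk (a : R) (i : 'I_n) (j : 'I_T) : 0 < a ->
    \rank (a *: delta_mx i j : 'M[R]_(n, T)) = 1%N.
  by move=> a0; rewrite mxrank_scale_nz ?gt_eqF// mxrank_delta.
have tZ (a : R) (A : 'M[R]_(n, T)) : (a *: A)^T = a *: A^T.
  exact: linearZ.
split; split=> //=; rewrite ?rk// ?normr0//.
- by rewrite tZ -scalemxAl -scalemxAr trmx_delta mul_delta_mx_0// !scaler0.
- by rewrite tZ -scalemxAl -scalemxAr trmx_delta mul_delta_mx_0// !scaler0.
- by rewrite frobenius_delta_mx// ltW.
- by rewrite frobenius_delta_mx// ltW.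
Qed.


Theorem theorem7 (R : realType) (n T : nat) (kappa1 kappa2 alpha : R)
    (CI : interval_estimator R n T) :
  (2 <= n)%N -> (2 <= T)%N ->
  0 < kappa1 -> 0 < kappa2 ->
  0 < alpha -> alpha < 1 / 2 ->
  valid_over Theta2 alpha CI ->
  (forall c : R, 0 < c -> c < 4 ->
     ((1 - 2 * alpha - c)%:E <=
      ereal_sup
        [set data_law theta
               [set xy | (c * (Num.sqrt (n * T)%:R)^-1 <= ci_length CI xy)%R]
        | theta in Theta1 kappa1 kappa2])%E)
  /\
  (((Num.sqrt (n * T)%:R)^-1 * (1 - 2 * alpha) ^+ 2 / 2)%:E <=
   ereal_sup
     [set 'E_(data_law theta)[ci_length CI]
     | theta in Theta1 kappa1 kappa2])%E.
Proof.
move=> n2 T2 k10 k20 a0 a12 valid.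
have n0 : (0 < n)%N := ltnW n2.
have T0 : (0 < T)%N := ltnW T2.
have N0 : (0 < n * T)%N by rewrite muln_gt0 n0.
set N := Num.sqrt (n * T)%:R.
have N2 : 2 <= N.
  rewrite -ler_sqr ?nnegrE ?sqrtr_ge0// sqr_sqrtr// -natrX ler_nat.
  exact: (leq_mul n2 T2).
have N_gt0 : 0 < N by apply: lt_le_trans N2.
pose th := Param ((kappa1 * N) *: delta_mx (Ordinal n0) (Ordinal T0))
  ((kappa2 * N) *: delta_mx (Ordinal n2) (Ordinal T2)) 1 1 0 : param R n T.
have thT : Theta1 kappa1 kappa2 th by exact: Theta1_orthogonal_spikes.
have [_ [rM _ _ _ _]] := thT; have [[_ _ _ rD _] _] := thT.
have bound c : 0 < c -> c <= 2 ->
    ((1 - 2 * alpha - c / 2)%:E <=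
     data_law th [set xy | (c * N^-1 <= ci_length CI xy)%R])%E.
  move=> c0 c2; apply: ci_length_ge_prob => //; first exact: le_trans N2.
  by rewrite [\rank _]rM.
split=> [c c0 c4|].
  apply: (@le_trans _ _
    (data_law th [set xy | (c * N^-1 <= ci_length CI xy)%R])); last first.
    by apply: ereal_sup_ubound; exists th.
  (* for c > 2 the left-hand side is negative *)
  have [c2|c2] := leP c 2.
    by apply: le_trans (bound _ c0 c2); rewrite lee_fin; lra.
  by apply: (@le_trans _ _ 0%E) => //; rewrite lee_fin; lra.
set b := 1 - 2 * alpha.
have b0 : 0 < b by rewrite /b; lra.
have b2 : b <= 2 by rewrite /b; lra.
apply: (@le_trans _ _ ('E_(data_law th)[ci_length CI])%E); last first.
  by apply: ereal_sup_ubound; exists th.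
have d0 : 0 <= b * N^-1 by rewrite divr_ge0 ?ltW.
apply: le_trans (ci_length_expectation_ge CI (data_law th) d0).
rewrite [leLHS](_ : _ = (b * N^-1)%:E * (b - b / 2)%:E)%E.
  by rewrite lee_wpmul2l ?lee_fin//; exact: bound.
by rewrite -EFinM; congr EFin; field; rewrite gt_eqF.
Qed.
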